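(* Let $K$ be a number field with set of places $X_K$, $S_0$ a finite subset of $X_K$ containing the set of Archimedean places, and $\Omega_{S_0}=X_K\setminus S_0$. The prime ideals of the adele ring ${\mathbb{A}}_K$ are completely described as follows. \begin{enumerate} \item The maximal ideals are of one of two kinds: (a) for $\upsilon_0\in X_K$, $M_{\upsilon_0}=\{\alpha\in{\mathbb{A}}_K\mid\alpha_{\upsilon_0}=0\}$, which is also a minimal prime ideal; (b) for a non-principal ultrafilter $\mathcal{U}$ on $\Omega_{S_0}$, $M_{\mathcal{U}}=\{\alpha\in{\mathbb{A}}_K\mid\{\upsilon\in\Omega_{S_0}\mid\alpha_\upsilon\in\mathfrak{m}_\upsilon\}\in\mathcal{U}\}$. \item The minimal prime ideals are of one of two kinds: (a) for $\upsilon_0\in X_K$, $M_{\upsilon_0}=\{\alpha\in{\mathbb{A}}_K\mid\alpha_{\upsilon_0}=0\}$, which is also maximal; (b) for a non-principal ultrafilter $\mathcal{U}$ on $\Omega_{S_0}$, $m_{\mathcal{U}}=\{\alpha\in{\mathbb{A}}_K\mid\{\upsilon\in\Omega_{S_0}\mid\alpha_\upsilon=0\}\in\mathcal{U}\}$, which is the only minimal prime ideal contained in $M_{\mathcal{U}}$, and $M_{\mathcal{U}}$ is the only maximal ideal containing it. \item If $\mathfrak{p}$ is a prime ideal of ${\mathbb{A}}_K$ that is neither maximal nor minimal, there is exactly one non-principal ultrafilter $\mathcal{U}$ on $\Omega_{S_0}$ such that $m_{\mathcal{U}}\subset\mathfrak{p}\subset M_{\mathcal{U}}$, and \[\mathfrak{p}=\bigcup_{\beta\in\mathfrak{p}\cap{\mathbb{A}}_{K,S_0}}\mathfrak{p}^\beta_{\mathcal{U}},\qquad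 \mathfrak{p}^\beta_{\mathcal{U}}=\{\alpha\in{\mathbb{A}}_K\mid\exists\,Y\in\mathcal{U},\ \exists\,n\in\mathbb{N}_{\ge1}:\ \upsilon(\alpha_\upsilon^n)\ge\upsilon(\beta_\upsilon)\ \forall\upsilon\in Y\}.\] \end{enumerate}
   Context: For each place $\upsilon$ of $K$, $K_\upsilon$ is the completion; for a non-Archimedean place, $\mathfrak{o}_\upsilon$ is the valuation ring with maximal ideal $\mathfrak{m}_\upsilon$, and $\upsilon$ also denotes the normalized discrete valuation $K_\upsilon\to\mathbb{Z}\cup\{\infty\}$, $\upsilon(0)=\infty$. The adele ring is ${\mathbb{A}}_K=\{(\alpha_\upsilon)\in\prod_{\upsilon\in X_K}K_\upsilon\mid \alpha_\upsilon\in\mathfrak{o}_\upsilon\text{ for almost all }\upsilon\}$, and ${\mathbb{A}}_{K,S_0}=\prod_{\upsilon\in S_0}K_\upsilon\times\prod_{\upsilon\notin S_0}\mathfrak{o}_\upsilon\subseteq{\mathbb{A}}_K$. An ultrafilter on a set $\Omega$ is a nonempty family of subsets not containing $\emptyset$, closed under finite intersections and supersets, and containing exactly one of each subset and its complement; it is principal if it consists of all subsets containing a fixed point, and non-principal otherwise. *)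

(* Defs.v *)
From HB Require Import structures.
From mathcomp Require Import all_boot all_order all_algebra all_field.
From mathcomp Require Import all_classical all_reals all_analysis.
From mathcomp Require Import ring lra.

Set Implicit Arguments.
Unset Strict Implicit.
Unset Printing Implicit Defensive.

Import Order.TTheory GRing.Theory Num.Theory.
Import numFieldNormedType.Exports.

Local Open Scope classical_set_scope.
Local Open Scope ring_scope.
Local Open Scope quotient_scope.

(* Absolute values are nontrivial by definition, and may be Archimedean. *)
Record absval (R : realType) (F : fieldType) := Absval {
  absval_fun :> F -> R;
  absval_ge0 : forall x, 0 <= absval_fun x;
  absval_eq0 : forall x, (absval_fun x == 0) = (x == 0);
  absvalM : forall x y, absval_fun (x * y) = absval_fun x * absval_fun y;
  absvalD_le : forall x y, absval_fun (x + y) <= absval_fun x + absval_fun y;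
  absval_nontriv : exists2 x, x != 0 & absval_fun x != 1 }.

HB.instance Definition _ (R : realType) (F : fieldType) :=
  gen_eqMixin (absval R F).
HB.instance Definition _ (R : realType) (F : fieldType) :=
  gen_choiceMixin (absval R F).

Section AbsvalTheory.
Variables (R : realType) (F : fieldType) (a : absval R F).

Lemma absval0 : a 0 = 0.
Proof. by apply/eqP; rewrite absval_eq0. Qed.

Lemma absval1 : a 1 = 1.
Proof.
have a1_neq0 : a 1 != 0 by rewrite absval_eq0 oner_eq0.
by apply: (mulfI a1_neq0); rewrite -absvalM !mulr1.
Qed.

Lemma absvalN x : a (- x) = a x.
Proof.
have aN1 : a (-1) = 1.
  apply/eqP; rewrite -(@eqrXn2 _ 2) ?absval_ge0// expr1n expr2 -absvalM.
  by rewrite mulrNN mulr1 absval1.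
by rewrite -mulN1r absvalM aN1 mul1r.
Qed.

Lemma absval_distC x y : a (x - y) = a (y - x).
Proof. by rewrite -absvalN opprB. Qed.

Lemma absvalB_le x y : a (x - y) <= a x + a y.
Proof. by rewrite (le_trans (absvalD_le _ _ _))// absvalN. Qed.

Lemma absval_gt0 x : (0 < a x) = (x != 0).
Proof. by rewrite lt0r absval_ge0 andbT absval_eq0. Qed.

Lemma absvalV x : a x^-1 = (a x)^-1.
Proof.
have [->|x0] := eqVneq x 0; first by rewrite invr0 absval0 invr0.
have ax0 : a x != 0 by rewrite absval_eq0.
by apply: (mulfI ax0); rewrite -absvalM !mulfV// absval1.
Qed.

Lemma ler_absval_dist x y : `|a x - a y| <= a (x - y).
Proof.
have := absvalD_le a (x - y) y; have := absvalD_le a (y - x) x.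
by rewrite !subrK absval_distC ler_norml; lra.
Qed.

End AbsvalTheory.

Section Completion.
Variables (R : realType) (F : fieldType) (a : absval R F).

Definition cauchy_seq : pred (nat -> F) := fun u =>
  `[< forall e : R, 0 < e ->
      exists N, forall m n, (N <= m)%N -> (N <= n)%N -> a (u m - u n) < e >].

Lemma cauchy_seqP u :
  reflect (forall e : R, 0 < e ->
      exists N, forall m n, (N <= m)%N -> (N <= n)%N -> a (u m - u n) < e)
    (u \in cauchy_seq).
Proof. exact: asboolP. Qed.

Lemma cauchy_seq_bounded u : u \in cauchy_seq ->
  exists2 M, 0 < M & forall n, a (u n) < M.
Proof.
move=> /cauchy_seqP/(_ 1 ltr01)[N uN].
exists (1 + \sum_(i < N.+1) a (u i)).
  by rewrite ltr_pwDl// sumr_ge0// => i _; rewrite absval_ge0.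
move=> n; have [nN|Nn] := ltnP n N.+1.
  rewrite (bigD1 (Ordinal nN))//= addrCA ltrDl ltr_pwDl//.
  by rewrite sumr_ge0// => i _; rewrite absval_ge0.
have := uN n N (ltnW Nn) (leqnn N).
have := absvalD_le a (u n - u N) (u N); rewrite subrK.
suff : a (u N) <= \sum_(i < N.+1) a (u i) by lra.
by rewrite (bigD1 ord_max)//= lerDl sumr_ge0// => i _; rewrite absval_ge0.
Qed.

Lemma cauchy_seq_subring : subring_closed cauchy_seq.
Proof.
split.
- apply/cauchy_seqP => e e0; exists 0%N => m n _ _.
  by rewrite subrr absval0.
- move=> u v /cauchy_seqP uC /cauchy_seqP vC; apply/cauchy_seqP => e e0.
  have e20 : 0 < e / 2 by rewrite divr_gt0.
  have [N uN] := uC _ e20; have [M vM] := vC _ e20.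
  exists (maxn N M) => m n; rewrite !geq_max => /andP[Nm Mm] /andP[Nn Mn].
  have := absvalB_le a (u m - u n) (v m - v n).
  have -> : (u m - u n) - (v m - v n) = (u - v) m - (u - v) n.
    by rewrite !fctE; ring.
  have := uN _ _ Nm Nn; have := vM _ _ Mm Mn; lra.
- move=> u v uC vC; apply/cauchy_seqP => e e0.
  have [A A0 uA] := cauchy_seq_bounded uC.
  have [B B0 vB] := cauchy_seq_bounded vC.
  have eB : 0 < e / 2 / B by rewrite !divr_gt0.
  have eA : 0 < e / 2 / A by rewrite !divr_gt0.
  have [N uN] := cauchy_seqP _ uC _ eB; have [M vM] := cauchy_seqP _ vC _ eA.
  exists (maxn N M) => m n; rewrite !geq_max => /andP[Nm Mm] /andP[Nn Mn].
  have := absvalD_le a ((u m - u n) * v m) (u n * (v m - v n)).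
  have -> : (u m - u n) * v m + u n * (v m - v n) = (u * v) m - (u * v) n.
    by rewrite !fctE; ring.
  move=> /le_lt_trans; apply; rewrite !absvalM [ltRHS]splitr ltr_leD//.
    have := uN _ _ Nm Nn; rewrite ltr_pdivlMr// => /le_lt_trans; apply.
    by rewrite ler_wpM2l ?absval_ge0 ?ltW.
  have := vM _ _ Mm Mn; rewrite ltr_pdivlMr// mulrC => /ltW; apply: le_trans.
  by rewrite ler_wpM2r ?absval_ge0 ?ltW.
Qed.

HB.instance Definition _ :=
  GRing.isSubringClosed.Build (nat -> F) cauchy_seq cauchy_seq_subring.

Record cauchy := Cauchy {
  cauchy_val :> nat -> F;
  cauchy_valP : cauchy_val \in cauchy_seq }.

HB.instance Definition _ := [isSub for cauchy_val].
HB.instance Definition _ := [Choice of cauchy by <:].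
HB.instance Definition _ :=
  [SubChoice_isSubComNzRing of cauchy by <:].

Definition null_seq : pred cauchy := fun u =>
  `[< a (u n) @[n --> \oo] --> (0 : R) >].

Lemma null_seqP (u : cauchy) :
  reflect (forall e : R, 0 < e ->
             exists N, forall n, (N <= n)%N -> a (u n) < e)
    (u \in null_seq).
Proof.
apply: (iffP (asboolP _)).
  move=> /cvgrPdist_lt u0 e /u0[N _ uN]; exists N => n /uN /=.
  by rewrite sub0r normrN ger0_norm ?absval_ge0.
move=> u0; apply/cvgrPdist_lt => e /u0[N uN]; exists N => // n /uN /=.
by rewrite sub0r normrN ger0_norm ?absval_ge0.
Qed.

Lemma null_seq_ideal : idealr_closed null_seq.
Proof.
split.
- by apply/null_seqP => e e0; exists 0%N => n _; rewrite absval0.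
- apply/negP => /null_seqP/(_ 1 ltr01)[N /(_ N (leqnn N))].
  by rewrite absval1 ltxx.
- move=> c u v /null_seqP uN /null_seqP vN; apply/null_seqP => e e0.
  have [C C0 cC] := cauchy_seq_bounded (cauchy_valP c).
  have eC : 0 < e / 2 / C by rewrite !divr_gt0.
  have e2 : 0 < e / 2 by rewrite divr_gt0.
  have [N {}uN] := uN _ eC; have [M {}vM] := vN _ e2.
  exists (maxn N M) => n; rewrite geq_max => /andP[/uN un /vM vn].
  rewrite [ltRHS]splitr (le_lt_trans (absvalD_le _ _ _))// ltr_leD ?(ltW vn)//.
  rewrite absvalM; move: un; rewrite ltr_pdivlMr// mulrC.
  by apply: le_lt_trans; rewrite ler_wpM2r ?absval_ge0 ?ltW.
Qed.

HB.instance Definition _ := isIdealr.Build cauchy null_seq null_seq_ideal.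

(* The completion of [F] at [a]: Cauchy sequences modulo null sequences. *)
Definition null_ideal : idealr cauchy := null_seq.
Definition completion : Type := {ideal_quot null_ideal}.

HB.instance Definition _ := GRing.ComNzRing.on completion.

Definition cauchy_lim (u : cauchy) : completion :=
  \pi_({ideal_quot null_ideal}) u.

Lemma cauchy_lim_eq (u v : cauchy) :
  (cauchy_lim u == cauchy_lim v) = (u - v \in null_seq).
Proof. by rewrite Quotient.idealrBE. Qed.

Lemma cauchy_lim0 : cauchy_lim 0 = 0.
Proof. exact: (rmorph0 \pi_({ideal_quot null_ideal})). Qed.

Lemma cauchy_lim1 : cauchy_lim 1 = 1.
Proof. exact: (rmorph1 \pi_({ideal_quot null_ideal})). Qed.

Lemma cauchy_limD u v : cauchy_lim (u + v) = cauchy_lim u + cauchy_lim v.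
Proof. exact: (rmorphD \pi_({ideal_quot null_ideal})). Qed.

Lemma cauchy_limM u v : cauchy_lim (u * v) = cauchy_lim u * cauchy_lim v.
Proof. exact: (rmorphM \pi_({ideal_quot null_ideal})). Qed.

Lemma completion_ind (P : completion -> Prop) :
  (forall u : cauchy, P (cauchy_lim u)) -> forall x, P x.
Proof. by move=> Pu x; rewrite -[x]reprK; exact: Pu. Qed.

Lemma not_null_seq (u : cauchy) : u \notin null_seq ->
  exists2 d, 0 < d & exists N, forall n, (N <= n)%N -> d <= a (u n).
Proof.
move=> u_nnull; have [e e0 ue] : exists2 e : R, 0 < e &
    forall N, exists2 n, (N <= n)%N & e <= a (u n).
  apply: contrapT => h; move/negP: u_nnull; apply; apply/null_seqP => e e0.
  apply: contrapT => h'; apply: h; exists e => // N; apply: contrapT => h.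
  apply: h'; exists N => n Nn; rewrite ltNge; apply/negP => en.
  by apply: h; exists n.
have e2 : 0 < e / 2 by rewrite divr_gt0.
exists (e / 2) => //; have [N uN] := cauchy_seqP _ (cauchy_valP u) _ e2.
exists N => n Nn; have [m Nm em] := ue N.
have := absvalD_le a (u m - u n) (u n); rewrite subrK.
have := uN _ _ Nm Nn; lra.
Qed.

Lemma cauchy_inv (u : cauchy) : u \notin null_seq ->
  (fun n => (u n)^-1) \in cauchy_seq.
Proof.
move=> /not_null_seq[d d0 [N uN]]; apply/cauchy_seqP => e e0.
have [M uM] := cauchy_seqP _ (cauchy_valP u) _ (mulr_gt0 e0 (mulr_gt0 d0 d0)).
exists (maxn N M) => m n; rewrite !geq_max => /andP[Nm Mm] /andP[Nn Mn].
have um := uN _ Nm; have un := uN _ Nn.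
have um0 : u m != 0 by rewrite -(absval_gt0 a) (lt_le_trans d0).
have un0 : u n != 0 by rewrite -(absval_gt0 a) (lt_le_trans d0).
have -> : (u m)^-1 - (u n)^-1 = (u n - u m) * ((u m)^-1 * (u n)^-1).
  by field; rewrite ?um0 ?un0.
have am0 : 0 < a (u m) by rewrite absval_gt0.
have an0 : 0 < a (u n) by rewrite absval_gt0.
rewrite !absvalM !absvalV -invfM ltr_pdivrMr ?mulr_gt0//.
apply: (lt_le_trans (uM _ _ Mn Mm)).
by rewrite ler_pM2l// ler_pM// ltW.
Qed.

Lemma completion_mulVx (x : completion) : x != 0 -> exists y, y * x = 1.
Proof.
elim/completion_ind: x => u u0.
have u_nnull : u \notin null_seq.
  by move: u0; rewrite -cauchy_lim0 cauchy_lim_eq subr0.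
exists (cauchy_lim (Cauchy (cauchy_inv u_nnull))).
rewrite -cauchy_limM.
rewrite -cauchy_lim1.
apply/eqP; rewrite cauchy_lim_eq; apply/null_seqP => e e0.
have [d d0 [N uN]] := not_null_seq u_nnull; exists N => n /uN dn.
have un0 : u n != 0 by rewrite -(absval_gt0 a) (lt_le_trans d0).
have -> : (Cauchy (cauchy_inv u_nnull) * u - 1) n = (u n)^-1 * u n - 1 by [].
by rewrite mulVf// subrr absval0.
Qed.

Definition completion_inv (x : completion) : completion :=
  xget 0 [set y | y * x = 1].

Lemma completion_mulVf (x : completion) :
  x != 0 -> completion_inv x * x = 1.
Proof.
by move=> /completion_mulVx x0; apply: (@xgetPex _ 0 [set y | y * x = 1]).
Qed.

Lemma completion_inv0 : completion_inv 0 = 0.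
Proof.
rewrite /completion_inv; case: xgetP => // y -> /eqP.
by rewrite mulr0 eq_sym oner_eq0.
Qed.

HB.instance Definition _ := GRing.ComNzRing_isField.Build completion
  completion_mulVf completion_inv0.

(* The unique continuous extension of [a]; [completion_abs_pi] below shows that
   it does not depend on the representative. *)
Definition completion_abs (x : completion) : R :=
  limn (fun n => a (repr x n)).

Lemma is_cvg_absval (u : cauchy) : cvgn (fun n => a (u n)).
Proof.
apply/cauchy_cvgP/cauchy_exP => e e0.
have [N uN] := cauchy_seqP _ (cauchy_valP u) _ e0.
exists (a (u N)); exists N => // n Nn; apply: le_lt_trans (uN _ _ (leqnn N) Nn).
exact: ler_absval_dist.
Qed.

Lemma cvg_completion_abs (u : cauchy) :
  a (u n) @[n --> \oo] --> completion_abs (cauchy_lim u).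
Proof.
suff -> : completion_abs (cauchy_lim u) =
    limn (fun n => a (u n)) by exact: is_cvg_absval.
rewrite /completion_abs; set v := repr _.
have : cauchy_lim v == cauchy_lim u by rewrite /cauchy_lim reprK.
rewrite cauchy_lim_eq => /null_seqP vu.
apply/eqP; rewrite -subr_eq0 -limB; [|exact: is_cvg_absval..].
apply/eqP/cvg_lim => //; apply/cvgrPdist_lt => e /vu[N uN]; exists N => // n.
move=> /uN uvn; rewrite sub0r normrN; apply: le_lt_trans uvn.
exact: ler_absval_dist.
Qed.


Arguments cvg_completion_abs : clear implicits.

Lemma completion_abs_ge0 x : 0 <= completion_abs x.
Proof.
elim/completion_ind: x => u.
by apply: limr_ge; [exact: is_cvg_absval|near=> n; exact: absval_ge0].
Unshelve. all: by end_near. Qed.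

Lemma completion_abs_eq0 x : (completion_abs x == 0) = (x == 0).
Proof.
elim/completion_ind: x => u.
rewrite -cauchy_lim0.
rewrite cauchy_lim_eq subr0; apply/eqP/asboolP => [<-|u0].
  exact: cvg_completion_abs.
by apply: (norm_cvg_unique _ u0); exact: cvg_completion_abs.
Qed.

Lemma completion_absM x y :
  completion_abs (x * y) = completion_abs x * completion_abs y.
Proof.
elim/completion_ind: x => u; elim/completion_ind: y => v.
rewrite -cauchy_limM.
have uv : (fun n => a (u n) * a (v n)) @ \oo -->
    completion_abs (cauchy_lim u) *
    completion_abs (cauchy_lim v).
  by apply: cvgM; exact: cvg_completion_abs.
apply: (norm_cvg_unique (cvg_completion_abs _)) => /=.
suff -> : (fun n => a ((u * v) n)) = (fun n => a (u n) * a (v n)) by [].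
by apply/funext => n; rewrite -absvalM.
Qed.

Lemma completion_absD_le x y :
  completion_abs (x + y) <= completion_abs x + completion_abs y.
Proof.
elim/completion_ind: x => u; elim/completion_ind: y => v.
rewrite -cauchy_limD.
have uv : (fun n => a (u n) + a (v n)) @ \oo -->
    completion_abs (cauchy_lim u) +
    completion_abs (cauchy_lim v).
  by apply: cvgD; exact: cvg_completion_abs.
apply: ler_cvg_to (cvg_completion_abs _) uv _.
by near=> n; exact: absvalD_le.
Unshelve. all: by end_near. Qed.

Lemma completion_abs_max :
  (forall x y, a (x + y) <= Num.max (a x) (a y)) ->
  forall x y, completion_abs (x + y) <=
              Num.max (completion_abs x) (completion_abs y).
Proof.
move=> aD x y; elim/completion_ind: x => u; elim/completion_ind: y => v.
rewrite -cauchy_limD.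
set M := Num.max _ _; apply/ler_addgt0Pr => e e0.
have uM : \forall n \near \oo, a (u n) < M + e.
  apply: (cvgr_lt _ (cvg_completion_abs u)).
  by rewrite ltr_pwDr// /M le_max lexx.
have vM : \forall n \near \oo, a (v n) < M + e.
  apply: (cvgr_lt _ (cvg_completion_abs v)).
  by rewrite ltr_pwDr// /M le_max lexx orbT.
apply: (ler_cvg_to (cvg_completion_abs _) (cvg_cst (M + e))).
near=> n; apply: (le_trans (aD _ _)); rewrite ge_max.
by apply/andP; split; apply: ltW; near: n.
Unshelve. all: by end_near. Qed.

Lemma cauchy_cst (x : F) : (fun=> x) \in cauchy_seq.
Proof. by apply/cauchy_seqP => e e0; exists 0%N => *; rewrite subrr absval0. Qed.

Definition to_completion (x : F) : completion :=
  cauchy_lim (Cauchy (cauchy_cst x)).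

Lemma completion_abs_cst x : completion_abs (to_completion x) = a x.
Proof.
apply: (norm_cvg_unique (cvg_completion_abs _)) => /=; exact: cvg_cst.
Qed.

Lemma completion_abs_nontriv : exists2 x, x != 0 & completion_abs x != 1.
Proof.
have [x x0 ax] := absval_nontriv a; exists (to_completion x).
  by rewrite -completion_abs_eq0 completion_abs_cst absval_eq0.
by rewrite completion_abs_cst.
Qed.

Definition completion_absval : absval R completion :=
  Absval completion_abs_ge0 completion_abs_eq0 completion_absM
    completion_absD_le completion_abs_nontriv.

End Completion.

Section Place.
Variables (R : realType) (F : fieldType).

(* Equivalence of absolute values; its classes are the places of [F]. *)
Definition absval_equiv : rel (absval R F) := fun a b =>
  `[< exists2 c : R, 0 < c & forall x, b x = a x `^ c >].

Lemma absval_equiv_refl : reflexive absval_equiv.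
Proof. by move=> a; apply/asboolP; exists 1 => // x; rewrite powRr1 ?absval_ge0. Qed.

Lemma absval_equiv_symW a b : absval_equiv a b -> absval_equiv b a.
Proof.
move=> /asboolP[c c0 ab]; apply/asboolP; exists c^-1; first by rewrite invr_gt0.
by move=> x; rewrite ab -powRrM mulfV ?gt_eqF// powRr1 ?absval_ge0.
Qed.

Lemma absval_equiv_sym : symmetric absval_equiv.
Proof. by move=> a b; apply/idP/idP; exact: absval_equiv_symW. Qed.

Lemma absval_equiv_trans : transitive absval_equiv.
Proof.
move=> b a c /asboolP[k k0 ab] /asboolP[l l0 bc]; apply/asboolP.
by exists (k * l); [rewrite mulr_gt0|move=> x; rewrite bc ab powRrM].
Qed.

Definition absval_eqrel : equiv_rel (absval R F) :=
  EquivRel absval_equiv absval_equiv_refl absval_equiv_sym absval_equiv_trans.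

Definition place : Type := {eq_quot absval_eqrel}.
HB.instance Definition _ := Choice.on place.

End Place.

Section Adele.
Variables (R : realType) (K : fieldExtType rat).
Implicit Type v : place R K.

Definition place_abs v : absval R K := repr v.

Definition nonarch v : Prop :=
  forall x y : K, place_abs v (x + y) <= Num.max (place_abs v x) (place_abs v y).

Definition Kv v : fieldType := completion (place_abs v).

Definition local_abs v : absval R (Kv v) := completion_absval (place_abs v).

(* The valuation ring and its maximal ideal when [v] is non-Archimedean. *)
Definition local_int v : set (Kv v) := [set x | local_abs v x <= 1].
Definition local_max v : set (Kv v) := [set x | local_abs v x < 1].

Definition normalized_valuation v (w : Kv v -> \bar int) : Prop :=
  [/\ forall x, w x = +oo%E <-> x = 0,
      forall x, w x <> -oo%E,
      forall x y, w (x * y) = (w x + w y)%E,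
      forall x y, (Order.min (w x) (w y) <= w (x + y)%R)%E &
      (exists x, w x = 1%:E) /\ (forall x, (0 <= w x)%E <-> local_int x)].

(* [normalized_valuation v] has exactly one inhabitant when [v] is
   non-Archimedean; the default value matters only for Archimedean [v]. *)
Definition ord_at v : Kv v -> \bar int :=
  xget (fun=> 0%E) [set w | normalized_valuation w].

Definition local_prod : Type := forall v, Kv v.
HB.instance Definition _ := Choice.on local_prod.

Section LocalProdRing.
Implicit Types f g h : local_prod.
Let ext f g : (forall v, f v = g v) -> f = g.
Proof. exact: functional_extensionality_dep. Qed.

Let add f g : local_prod := fun v => f v + g v.
Let opp f : local_prod := fun v => - f v.
Let mul f g : local_prod := fun v => f v * g v.

Let addA : associative add.
Proof. by move=> f g h; apply: ext => v; exact: addrA. Qed.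
Let addC : commutative add.
Proof. by move=> f g; apply: ext => v; exact: addrC. Qed.
Let add0 : left_id (fun=> 0) add.
Proof. by move=> f; apply: ext => v; exact: add0r. Qed.
Let addN : left_inverse (fun=> 0) opp add.
Proof. by move=> f; apply: ext => v; exact: addNr. Qed.
HB.instance Definition _ := GRing.isZmodule.Build local_prod addA addC add0 addN.

Let mulA : associative mul.
Proof. by move=> f g h; apply: ext => v; exact: mulrA. Qed.
Let mulC : commutative mul.
Proof. by move=> f g; apply: ext => v; exact: mulrC. Qed.
Let mul1 : left_id (fun=> 1) mul.
Proof. by move=> f; apply: ext => v; exact: mul1r. Qed.
Let mulD : left_distributive mul add.
Proof. by move=> f g h; apply: ext => v; exact: mulrDl. Qed.
HB.instance Definition _ :=
  GRing.Zmodule_isComPzRing.Build local_prod mulA mulC mul1 mulD.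
End LocalProdRing.

(* Archimedean places, where there is no valuation ring, impose no condition. *)
Definition almost_int : pred local_prod := fun f =>
  `[< finite_set [set v | nonarch v /\ ~ local_int (f v)] >].

Lemma local_intB v (x y : Kv v) : nonarch v ->
  local_int x -> local_int y -> local_int (x - y).
Proof.
move=> vna x1 y1; change (local_abs v (x - y) <= 1).
apply: le_trans (completion_abs_max vna _ _) _.
by rewrite ge_max x1 [leLHS](absvalN (local_abs v)).
Qed.

Lemma local_intM v (x y : Kv v) :
  local_int x -> local_int y -> local_int (x * y).
Proof.
move=> x1 y1; change (local_abs v (x * y) <= 1).
by rewrite absvalM mulr_ile1 ?absval_ge0.
Qed.

Lemma almost_int_subring : subring_closed almost_int.
Proof.
split.
- apply/asboolP; apply: sub_finite_set (finite_set0 _) => v [_]; apply.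
  by change (local_abs v 1 <= 1); rewrite absval1.
- move=> f g /asboolP fA /asboolP gA; apply/asboolP.
  have : finite_set ([set v | nonarch v /\ ~ local_int (f v)] `|`
                     [set v | nonarch v /\ ~ local_int (g v)]).
    by rewrite finite_setU.
  apply: sub_finite_set => v [vna fg] /=.
  apply: contrapT => /not_orP[/not_andP[//|/contrapT f1] /not_andP[//|/contrapT g1]].
  by apply: fg; apply: local_intB.
- move=> f g /asboolP fA /asboolP gA; apply/asboolP.
  have : finite_set ([set v | nonarch v /\ ~ local_int (f v)] `|`
                     [set v | nonarch v /\ ~ local_int (g v)]).
    by rewrite finite_setU.
  apply: sub_finite_set => v [vna fg] /=.
  apply: contrapT => /not_orP[/not_andP[//|/contrapT f1] /not_andP[//|/contrapT g1]].
  by apply: fg; apply: local_intM.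
Qed.

HB.instance Definition _ :=
  GRing.isSubringClosed.Build local_prod almost_int almost_int_subring.

Record adele := Adele {
  adele_val : local_prod;
  adele_valP : adele_val \in almost_int }.

HB.instance Definition _ := [isSub for adele_val].
HB.instance Definition _ := [Choice of adele by <:].
HB.instance Definition _ :=
  GRing.SubChoice_isSubComPzRing.Build local_prod almost_int adele
    almost_int_subring.

Definition component (alpha : adele) v : Kv v := adele_val alpha v.
Coercion component : adele >-> Funclass.

Definition int_adele (S0 : set (place R K)) : set adele :=
  [set alpha : adele | forall v, ~ S0 v -> local_int (alpha v)].

End Adele.

Section Ideals.
Variable A : comPzRingType.
Implicit Types I J : set A.

(* As the zero ring is not excluded, the ideals of [ring_quotient], which ask
   for a nontrivial ring, are not available. *)
Definition is_ideal I : Prop :=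
  [/\ I 0, forall x y, I x -> I y -> I (x + y) & forall x y, I y -> I (x * y)].

Definition is_proper_ideal I : Prop := is_ideal I /\ ~ I 1.

Definition prime_ideal I : Prop :=
  is_proper_ideal I /\ forall x y, I (x * y) -> I x \/ I y.

Definition maximal_ideal I : Prop :=
  is_proper_ideal I /\ forall J, is_proper_ideal J -> I `<=` J -> J = I.

Definition minimal_prime_ideal I : Prop :=
  prime_ideal I /\ forall J, prime_ideal J -> J `<=` I -> J = I.

End Ideals.

Section Ultrafilter.
Variable T : Type.

Definition nonprincipal_ultrafilter (U : set_system T) : Prop :=
  UltraFilter U /\ ~ exists x, U = principal_filter x.

(* The library's maximal proper filters are the ultrafilters in the sense of
   deciding between each set and its complement. *)
Lemma ultrafilterP (U : set_system T) :
  UltraFilter U <->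
  [/\ U !=set0, ~ U set0, forall A B, U A -> U B -> U (A `&` B),
      forall A B, A `<=` B -> U A -> U B &
      forall A, (U A /\ ~ U (~` A)) \/ (~ U A /\ U (~` A))].
Proof.
split=> [UU|[[Y UY] U0 UI US UC]].
  split.
  - by exists setT; exact: filterT.
  - exact: filter_not_empty.
  - by move=> A B; exact: filterI.
  - by move=> A B; exact: filterS.
  - move=> A; have excl : U A -> ~ U (~` A).
      move=> UA UnA; apply: (@filter_not_empty _ U _).
      by rewrite -(setICr A); exact: filterI.
    by have [UA|UnA] := in_ultra_setVsetC A UU; [left|right]; split=> // /excl.
have UF : ProperFilter U.
  by split=> //; split=> //; apply: US UY.
split=> // G GF UG; apply/seteqP; split=> // A GA.
have [[]//|[_ UnA]] := UC A; exfalso.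
by apply: (@filter_not_empty _ G _); rewrite -(setICr A); apply: filterI; last exact: UG.
Qed.

End Ultrafilter.

Section AdelePrimes.
Variables (R : realType) (K : fieldExtType rat) (S0 : set (place R K)).

Definition Omega : Type := ~` S0.

Definition M_place (v0 : place R K) : set (adele R K) :=
  [set alpha : adele R K | alpha v0 = 0].

Definition M_ultra (U : set_system Omega) : set (adele R K) :=
  [set alpha : adele R K | U [set v : Omega | local_max (alpha (val v))]].

Definition m_ultra (U : set_system Omega) : set (adele R K) :=
  [set alpha : adele R K | U [set v : Omega | alpha (val v) = 0]].

Definition p_ultra (U : set_system Omega) (beta : adele R K) : set (adele R K) :=
  [set alpha : adele R K | exists2 Y, U Y & exists2 n, (1 <= n)%N &
    forall v : Omega, Y v ->
      (ord_at (beta (val v)) <= ord_at (alpha (val v) ^+ n))%E].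

End AdelePrimes.

(* Main.v *)
(** Let [p] be a prime ideal of the adele ring. If some idempotent [1_v] supported
    at a single place is outside [p], then [1 - 1_v] is in [p], so [p] contains,
    hence equals, the maximal ideal [M_place v]. Otherwise the sets [Z] of places
    outside [S0] whose indicator idempotent is outside [p] form a non-principal
    ultrafilter [U], and [m_ultra U `<=` p `<=` M_ultra U]: an adele vanishing on a
    member of [U] is killed by an idempotent outside [p], and an adele that is not
    in [M_ultra U] divides such an idempotent. Inclusions between [m_ultra U'] and
    [M_ultra U] force [U' = U].

    The description of [p] through [p_ultra] reduces to dividing [alpha ^+ n] by
    [beta] wherever the former has the smaller absolute value. It needs a
    normalized valuation to exist at every non-Archimedean place: for [x] in
    [K^*], two terms of a linear relation between [1, x, .., x ^+ [K : Q]] have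
    equal absolute value, so [|x| ^+ [K : Q]`!] lies in the cyclic value group of
    [Q], and the value group of [K] is discrete. *)

Require Import Defs.
From mathcomp Require Import all_boot all_order all_algebra all_field.
From mathcomp Require Import all_classical all_reals all_analysis.
From mathcomp Require Import ring zify.

Local Open Scope classical_set_scope.

Section PrimesOfAdeleRing.
Set Implicit Arguments.
Unset Strict Implicit.
Unset Printing Implicit Defensive.
Import Order.TTheory GRing.Theory Num.Theory.
Import numFieldNormedType.Exports.
Local Open Scope ring_scope.

(** * Discreteness of non-Archimedean absolute values of number fields *)

Section NonArch.
Variables (R : realType) (F : fieldType) (a : absval R F).
Hypothesis aD : forall x y, a (x + y) <= Num.max (a x) (a y).

Lemma absvalX x n : a (x ^+ n) = a x ^+ n.
Proof.
by elim: n => [|n IHn]; rewrite ?expr0 ?absval1// !exprS absvalM IHn.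
Qed.

Lemma absvalXz x (n : int) : a (x ^ n) = a x ^ n.
Proof. by case: n => n; rewrite ?NegzE -?exprnN ?absvalV -?exprnP absvalX. Qed.

Lemma nonarch_nat n : a n%:R <= 1.
Proof.
elim: n => [|n IHn]; first by rewrite absval0.
by rewrite -addn1 natrD (le_trans (aD _ _))// ge_max IHn absval1/=.
Qed.

Lemma nonarch_ltD x y : a x < a y -> a (x + y) = a y.
Proof.
move=> xy; apply/eqP; rewrite eq_le; apply/andP; split.
  by rewrite (le_trans (aD _ _))// ge_max lexx (ltW xy).
have := aD (x + y) (- x); rewrite addrAC subrr add0r absvalN le_max.
by case/orP => //; rewrite leNgt xy.
Qed.

Lemma nonarch_sum_lt (I : finType) (P : pred I) (f : I -> F) (e : R) : 0 < e ->
  (forall i, P i -> a (f i) < e) -> a (\sum_(i | P i) f i) < e.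
Proof.
move=> e0 fe; apply: (big_ind (fun x => a x < e)) => // [|x y xe ye].
  by rewrite absval0.
by rewrite (le_lt_trans (aD _ _))// gt_max xe ye.
Qed.

(* In a vanishing sum the largest absolute value is attained twice. *)
Lemma nonarch_sum0 (I : finType) (f : I -> F) (i0 : I) :
  f i0 != 0 -> \sum_i f i = 0 ->
  exists i j, [/\ i != j, f i != 0 & a (f i) = a (f j)].
Proof.
move=> fi0 sum0; have [i _ imax] := arg_maxP (fun i => a (f i)) (isT : xpredT i0).
have ai : 0 < a (f i) by rewrite (lt_le_trans _ (imax i0 isT))// absval_gt0.
apply: contrapT => nij.
have : a (\sum_(j | j != i) f j) < a (f i).
  apply: nonarch_sum_lt => // j ji; rewrite lt_neqAle [_ <= _]imax// andbT.
  apply/eqP => aji; apply: nij; exists i, j; split=> //; first by rewrite eq_sym.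
  by rewrite -(absval_gt0 a).
move: sum0; rewrite (bigD1 i)//= => /eqP; rewrite addr_eq0 => /eqP ->.
by rewrite absvalN ltxx.
Qed.

(* The least natural number of absolute value less than 1 is a uniformizer of
   the prime field. *)
Lemma nonarch_nat_pow (q : nat) : (0 < q)%N ->
    (forall r, (0 < r < q)%N -> a r%:R = 1) -> a q%:R < 1 ->
  forall m, a m%:R != 0 -> exists k : nat, a m%:R = a q%:R ^+ k.
Proof.
move=> q0 qmin aq m; have [n] := ubnP m; elim: n m => // n IHn m mn am0.
have m0 : (0 < m)%N by case: m am0 {mn} => //; rewrite absval0 eqxx.
have q1 : (1 < q)%N.
  by case: q q0 aq {qmin IHn} => [|[|]]//; rewrite absval1 ltxx.
have [r0|r0] := posnP (m %% q)%N.
  move: am0; rewrite (divn_eq m q) r0 addn0 natrM absvalM mulf_eq0 negb_or.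
  move=> /andP[am0 _]; have [|k ->] := IHn (m %/ q)%N _ am0.
    by have := ltn_Pdiv q1 m0; lia.
  by exists k.+1; rewrite exprSr.
have ar : a (m %% q)%:R = 1 by rewrite qmin// r0 ltn_pmod.
exists 0%N; rewrite expr0 {1}(divn_eq m q) natrD nonarch_ltD// ar.
rewrite natrM absvalM (le_lt_trans _ aq)// ler_piMl ?absval_ge0//.
exact: nonarch_nat.
Qed.

End NonArch.

Section NumberField.
Variables (R : realType) (K : fieldExtType rat) (a : absval R K).
Hypothesis aD : forall x y, a (x + y) <= Num.max (a x) (a y).

(** The powers [x ^+ i] for [i] up to the degree are linearly dependent over the rationals, and
    [nonarch_sum0] finds two terms of equal absolute value in the relation. The bound on [d] makes
    it divide a factorial that does not depend on [x]. *)
Lemma absval_pow_rat (x : K) : x != 0 ->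
  exists (d : nat) (r s : int), [/\ (0 < d <= \dim {:K})%N, r != 0, s != 0 &
    a (r%:~R) * a x ^+ d = a s%:~R].
Proof.
move=> x0; set n := \dim {:K}.
pose X := [tuple x ^+ (val i) | i < n.+1].
have : ~~ free X.
  apply/eqP => h.
  by have := dimvS (subvf <<X>>%VS); rewrite h size_tuple ltnn.
move=> /freeP nX.
have [k [sk [i0 ki0]]] : exists k : 'I_n.+1 -> rat,
    \sum_(i < n.+1) k i *: X`_i = 0 /\ exists i, k i != 0.
  apply: contrapT => h; apply: nX => k sk i; apply: contrapT => /eqP ki.
  by apply: h; exists k; split=> //; exists i.
have XE (i : 'I_n.+1) : X`_i = x ^+ i by rewrite -tnth_nth tnth_mktuple.
have [i [j [ij fi0 fij]]] :
    exists i j : 'I_n.+1, [/\ i != j, k i *: X`_i != 0 &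
                              a (k i *: X`_i) = a (k j *: X`_j)].
  by apply: (nonarch_sum0 aD (i0 := i0)); rewrite // XE scaler_eq0 negb_or ki0 expf_neq0.
have ratE (q : rat) (y : K) : a (q *: y) = a (numq q)%:~R / a (denq q)%:~R * a y.
  rewrite -mulr_algl absvalM; congr (_ * _).
  rewrite -{1}[q]divq_num_den -absvalV -absvalM; congr (a _).
  by rewrite [LHS](fmorph_div (in_alg K)) !(rmorph_int (in_alg K)).
have kj0 : k j *: X`_j != 0 by rewrite -(absval_gt0 a) -fij absval_gt0.
wlog ltij : i j ij fi0 kj0 fij / (i < j)%N.
  move=> wl; move: (ij); rewrite neq_ltn => /orP[]; first exact: (wl i j).
  by apply: (wl j i) => //; rewrite eq_sym.
move: fi0 kj0 fij; rewrite !XE !ratE !scaler_eq0 !negb_or => /andP[ki _] /andP[kj _] e.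
have axi : a (x ^+ i) != 0 by rewrite absval_eq0 expf_neq0.
have K0 (z : int) : z != 0 -> a (z%:~R) != 0.
  by move=> z0; rewrite absval_eq0 -(rmorph_int (in_alg K)) fmorph_eq0 intr_eq0.
have di := K0 _ (denq_neq0 (k i)); have dj := K0 _ (denq_neq0 (k j)).
(* Cancelling [x ^+ i] leaves [x ^+ (j - i)]; cross-multiplying by the denominators makes both
   coefficients integers. *)
exists (j - i)%N, (numq (k j) * denq (k i)), (numq (k i) * denq (k j)).
split; rewrite ?mulf_neq0 ?numq_eq0//.
  by rewrite subn_gt0 ltij leq_subLR; have := ltn_ord j; lia.
have xj : x ^+ j = x ^+ (j - i) * x ^+ i by rewrite -exprD subnK// ltnW.
move: e; rewrite xj absvalM mulrA => /(mulIf axi) e.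
rewrite !intrM !absvalM -absvalX.
set A := a _ in e *; set B := a _ in e di *.
have -> : A * a (denq (k j))%:~R = A / B * (B * a (denq (k j))%:~R) by field; exact: di.
by rewrite e; field; exact: dj.
Qed.

Lemma absval_int (z : int) : a z%:~R = a `|z|%N%:R.
Proof.
by case: z => n //; rewrite NegzE mulrNz absvalN abszN.
Qed.

(** Otherwise all nonzero integers have absolute value 1, so by [absval_pow_rat] every nonzero [x]
    has a power of absolute value 1, and [a] is trivial. *)
Lemma exists_nat_lt1 : exists q : nat, (0 < q)%N && (a q%:R < 1).
Proof.
apply: contrapT => nq.
have a1 (z : int) : z != 0 -> a z%:~R = 1.
  move=> z0; rewrite absval_int; apply/eqP; rewrite eq_le nonarch_nat//= leNgt.
  by apply/negP => az; apply: nq; exists `|z|%N; rewrite absz_gt0 z0.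
have [x x0 /eqP] := absval_nontriv a; apply.
have [d [r [s [/andP[d0 _] r0 s0]]]] := absval_pow_rat x0.
by rewrite !a1// mul1r => /eqP; rewrite pexpr_eq1 ?absval_ge0// => /eqP.
Qed.

Lemma absval_pow_cyclic : exists2 T : R, 1 < T & exists2 N : nat, (0 < N)%N &
  forall x, x != 0 -> exists k : int, a x ^+ N = T ^ k.
Proof.
have [q /andP[q0 aq] qmin] := ex_minnP exists_nat_lt1.
have aq0 : 0 < a q%:R.
  rewrite absval_gt0 -(rmorph_nat (in_alg K)) fmorph_eq0 pnatr_eq0.
  by rewrite -lt0n.
exists (a q%:R)^-1; first by rewrite invf_gt1.
have q1 r : (0 < r < q)%N -> a r%:R = 1.
  move=> /andP[r0 rq]; apply/eqP; rewrite eq_le nonarch_nat//= leNgt.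
  by apply/negP => ar; have := qmin r; rewrite r0 ar leqNgt rq; exact/implyP.
have powZ (z : int) : z != 0 -> exists k : nat, a z%:~R = a q%:R ^+ k.
  move=> z0; rewrite absval_int; apply: nonarch_nat_pow => //.
  by rewrite absval_eq0 -(rmorph_nat (in_alg K)) fmorph_eq0 pnatr_eq0 absz_eq0.
exists (\dim {:K})`!; first exact: fact_gt0.
move=> x x0; have [d [r [s [dn r0 s0]]]] := absval_pow_rat x0.
have [i ->] := powZ _ r0; have [j ->] := powZ _ s0 => ijE.
have /dvdnP[m ->] : (d %| (\dim {:K})`!)%N by exact: dvdn_fact.
(* With [T] the inverse of [a q%:R], the relation reads [a x ^+ d = T ^ (i - j)]; raise it to the
   power [m], where [m * d] is the factorial. *)
exists ((i%:Z - j%:Z) * m); rewrite mulnC exprM exprnP -exprz_exp; congr (_ ^ _).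
have ax : a x ^+ d = a q%:R ^+ j / a q%:R ^+ i.
  by rewrite -ijE mulrC mulKf// expf_neq0// gt_eqF.
by rewrite ax exprz_inv opprB expfzDr ?gt_eqF// exprnN.
Qed.

End NumberField.

(** * Normalized valuations from discrete value groups *)

Section DiscreteValuation.
Variables (R : realType) (F : fieldType) (a : absval R F).
Hypothesis aD : forall x y, a (x + y) <= Num.max (a x) (a y).
Variables (T : R) (N : nat).
Hypotheses (T1 : 1 < T) (N0 : (0 < N)%N).
Hypothesis powT : forall x, x != 0 -> exists k : int, a x ^+ N = T ^ k.

(** The exponent of [T] in [a x ^+ N], with sign reversed, is an integer valuation that need not be
    onto. Its values are the multiples of the least positive one, and dividing by that one
    normalizes it. *)
Lemma exists_valuation : exists w : F -> \bar int,
  [/\ forall x, w x = +oo%E <-> x = 0,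
      forall x, w x <> -oo%E,
      forall x y, w (x * y) = (w x + w y)%E,
      forall x y, (Order.min (w x) (w y) <= w (x + y)%R)%E &
      (exists x, w x = 1%:E) /\ (forall x, (0 <= w x)%E <-> a x <= 1)].
Proof.
have T0 : 0 < T by exact: lt_trans ltr01 T1.
have [k kP] : {k : F -> int & forall x, x != 0 -> a x ^+ N = T ^ (- k x)}.
  apply: (choice (P := fun x k => x != 0 -> a x ^+ N = T ^ (- k))) => x.
  have [->|/powT[k ak]] := eqVneq x 0; first by exists 0 => /eqP.
  by exists (- k) => _; rewrite opprK.
have kI x z : x != 0 -> a x ^+ N = T ^ (- z) -> k x = z.
  move=> x0; rewrite kP// => /ieexprIz.
  by move=> /(_ T0 (negbT (gt_eqF T1))) /oppr_inj.
have k_le x y : x != 0 -> y != 0 -> (k x <= k y) = (a y <= a x).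
  move=> x0 y0; rewrite -[RHS](ler_pXn2r N0) ?nnegrE ?absval_ge0// !kP//.
  by rewrite ler_eXz2l// lerN2.
have kM x y : x != 0 -> y != 0 -> k (x * y) = k x + k y.
  move=> x0 y0; apply: kI; first by rewrite mulf_neq0.
  by rewrite absvalM exprMn !kP// opprD expfzDr// gt_eqF.
have k1 : k 1 = 0 by apply: kI; rewrite ?oner_eq0// absval1 expr1n.
have kXz x (z : int) : x != 0 -> k (x ^ z) = z * k x.
  move=> x0; apply: kI; first by rewrite expfz_neq0.
  by rewrite absvalXz exprnP exprzAC -exprnP kP// exprz_exp mulrC mulrN.
have exm : exists m : nat, `[< exists x, [/\ x != 0, (0 < m)%N & k x = m] >].
  (* Nontriviality gives a nonzero exponent; inverting [x] if necessary makes it positive. *)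
  have [x x0 ax1] := absval_nontriv a.
  have kx0 : k x != 0.
    apply/eqP => kx; move/eqP: ax1; apply.
    have /eqP : a x ^+ N = 1 by rewrite kP// kx.
    by rewrite pexpr_eq1 ?absval_ge0// => /eqP.
  exists `|k x|%N; apply/asboolP; exists (x ^ sgz (k x)); split.
  - by rewrite expfz_neq0.
  - by rewrite absz_gt0.
  - by rewrite kXz// abszEsg.
have [d /asboolP[pi [pi0 d0 kpi]] dmin] := ex_minnP exm.
have dvd x : x != 0 -> (d %| k x)%Z.
  move=> x0; apply/dvdz_mod0P; apply/eqP; apply: contrapT => /negP r0.
  have dZ : (d : int) != 0 by rewrite -lt0n.
  (* The exponent of [y] is the remainder of [k x] modulo [d]; if nonzero, it would contradict the
     minimality of [d]. *)
  pose y := x * pi ^ (- (k x %/ d)%Z).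
  have y0 : y != 0 by rewrite mulf_neq0// expfz_neq0.
  have ky : k y = (k x %% d)%Z.
    rewrite kM ?expfz_neq0// kXz// kpi mulNr {1}(divz_eq (k x) d).
    by rewrite addrAC subrr add0r.
  have := modz_ge0 (k x) dZ; have := @ltz_pmod (k x) d d0.
  move: r0 ky; case: (k x %% d)%Z => // r r0 ky rd _.
  have /dmin : `[< exists x, [/\ x != 0, (0 < r)%N & k x = r] >].
    by apply/asboolP; exists y; split=> //; rewrite lt0n.
  by rewrite leqNgt -ltz_nat rd.
exists (fun x => if x == 0 then +oo%E else ((k x %/ d)%Z)%:E); split.
- by move=> x; case: eqP.
- by move=> x; case: eqP.
- move=> x y; rewrite mulf_eq0; case: eqP => [_|/eqP x0]/=.
    by rewrite addye//; case: (y == 0).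
  case: eqP => [_|/eqP y0]; first by rewrite addey.
  by rewrite -EFinD kM// divzDl// dvd.
- move=> x y; case: (eqVneq (x + y) 0) => [_|xy0]; first by rewrite leey.
  case: eqP => [x0|/eqP x0].
    by move: xy0; rewrite x0 add0r => /negbTE ->; rewrite ge_min lexx orbT.
  case: eqP => [y0|/eqP y0]; first by rewrite y0 addr0 ge_min lexx.
  rewrite ge_min !lee_fin; have := aD x y; rewrite le_max -!k_le// => /orP[]kxy.
    by rewrite lez_pdiv2r.
  by apply/orP; right; exact: lez_pdiv2r.
- split.
    by exists pi; rewrite (negbTE pi0) kpi divzz -lt0n d0.
  move=> x; case: eqP => [->|/eqP x0]; first by rewrite absval0 ler01 leey.
  by rewrite lee_fin divz_ge0// -k1 k_le ?oner_eq0// absval1.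
Qed.

End DiscreteValuation.

(** * Absolute values on the completion *)

Section Completion.
Variables (R : realType) (F : fieldType) (a : absval R F).
Hypothesis aD : forall x y, a (x + y) <= Num.max (a x) (a y).

(** The terms of a non-null Cauchy sequence eventually stay above some [d] in absolute value and
    differ by less than [d], so their absolute values are eventually constant. Hence completing adds
    no new values. *)
Lemma nonarch_completion_abs (x : completion a) : x != 0 ->
  exists2 y : F, y != 0 & completion_abs x = a y.
Proof.
elim/completion_ind: x => u u0.
have : u \notin @null_seq R F a by move: u0; rewrite -cauchy_lim0 cauchy_lim_eq subr0.
move=> /not_null_seq[d d0 [N uN]].
have [M uM] := elimT (cauchy_seqP a u) (cauchy_valP u) _ d0.
pose n0 := maxn N M; have dn0 : d <= a (u n0) by rewrite uN// leq_maxl.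
exists (u n0); first by rewrite -(absval_gt0 a) (lt_le_trans d0).
apply: (norm_cvg_unique (@cvg_completion_abs _ _ a u)); apply: cvg_near_cst.
exists n0 => // n /= n0n; rewrite -[u n](subrK (u n0)) nonarch_ltD//.
by rewrite (lt_le_trans _ dn0)// uM// ?leq_maxr// (leq_trans _ n0n)// leq_maxr.
Qed.

End Completion.

Lemma ord_atP (R : realType) (K : fieldExtType rat) (v : place R K) :
  nonarch v -> normalized_valuation (@ord_at R K v).
Proof.
move=> vna; apply: (@xgetPex _ (fun=> 0%E) [set w : Kv v -> _ | normalized_valuation w]).
have [T T1 [N N0 powT]] := absval_pow_cyclic vna.
have vD := completion_abs_max vna.
apply: (exists_valuation (a := local_abs v) vD T1 N0) => x x0.
have [y y0 xy] := nonarch_completion_abs vna x0.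
by have [k yk] := powT y y0; exists k; rewrite -yk -xy.
Qed.

(** For nonzero [x] the comparison says that [y / x] is integral, and [ord_at] and [local_abs v]
    have the same valuation ring. *)
Lemma ord_at_le (R : realType) (K : fieldExtType rat) (v : place R K)
    (x y : Kv v) : nonarch v ->
  (ord_at x <= ord_at y)%E -> local_abs v y <= local_abs v x.
Proof.
move=> /ord_atP[w0 wNy wM _ [_ wint]] xy.
have [x0|x0] := eqVneq x 0.
  have /w0 -> : ord_at y = +oo%E.
    by apply/eqP; move: xy; rewrite x0 (w0 0).2// leye_eq.
  by rewrite x0.
suff : local_abs v (y / x) <= 1.
  by rewrite absvalM absvalV ler_pdivrMr ?absval_gt0// mul1r.
apply/wint; move: xy; rewrite -{1}(divfK x0 y) (wM (y / x)).
have : ord_at x <> +oo%E by move/w0/eqP; rewrite (negbTE x0).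
have := wNy x; case: (ord_at x) => // r _ _.
case: (ord_at (y / x)) => // s.
by rewrite -EFinD !lee_fin; lia.
Qed.

(** * Prime ideals and ultrafilters *)

Lemma maximal_prime (A : comPzRingType) (M : set A) :
  maximal_ideal M -> prime_ideal M.
Proof.
move=> [[[M0 MD MM] M1] Mmax]; split=> // x y Mxy.
apply: contrapT => /not_orP[nMx nMy].
pose J := [set z | exists m a, M m /\ z = m + a * x].
have MJ : M `<=` J by move=> m Mm; exists m, 0; rewrite mul0r addr0.
have JI : is_ideal J.
  split.
  - exact: MJ.
  - move=> _ _ [m [a [Mm ->]]] [n [b [Mn ->]]]; exists (m + n), (a + b).
    by split; [exact: MD|rewrite mulrDl addrACA].
  - move=> c _ [m [a [Mm ->]]]; exists (c * m), (c * a).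
    by split; [exact: MM|rewrite mulrDr mulrA].
have Jx : J x by exists 0, 1; rewrite add0r mul1r.
have [[m [a [Mm e1]]]|nJ1] := pselect (J 1).
  apply: nMy; rewrite -[y]mul1r e1 mulrDl -mulrA; apply: MD; last exact: MM.
  by rewrite mulrC; exact: MM.
by apply: nMx; rewrite -(Mmax J).
Qed.

Lemma prime_idealX (A : comPzRingType) (p : set A) (x : A) n :
  prime_ideal p -> p (x ^+ n) -> p x.
Proof.
move=> [[_ p1] pP]; elim: n => [|n IHn]; first by rewrite expr0 => /p1.
by rewrite exprS => /pP[].
Qed.

Lemma ultrafilter_disjoint T (U : set_system T) (A B : set T) :
  UltraFilter U -> U A -> U B -> A `&` B = set0 -> False.
Proof.
move=> UU UA UB AB0; apply: (@filter_not_empty _ U _).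
by rewrite -AB0; exact: filterI.
Qed.

(** All members of an ultrafilter containing [[set x]] contain [x], so by maximality it is the
    principal filter at [x]. *)
Lemma nonprincipal_set1 T (U : set_system T) (x : T) :
  nonprincipal_ultrafilter U -> ~ U [set x].
Proof.
move=> [UU Unp] Ux; apply: Unp; exists x; symmetry.
apply: max_filter => [|A UA]; first exact: principal_filter_proper.
apply/principal_filterP; apply: contrapT => nAx.
apply: (ultrafilter_disjoint UU UA Ux).
by apply/seteqP; split=> // y [Ay /= yx]; apply: nAx; rewrite -yx.
Qed.

Lemma set_seq_cons (T : choiceType) (x : T) s :
  [set` x :: s] = [set x] `|` [set` s].
Proof.
apply/seteqP; split=> y /=; rewrite inE; first by case/predU1P; [left|right].
by case=> [->|ys]; apply/orP; [left; rewrite eqxx|right].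
Qed.

Lemma nonprincipal_finite (T : choiceType) (U : set_system T) (F : set T) :
  nonprincipal_ultrafilter U -> finite_set F -> ~ U F.
Proof.
move=> Unp /finite_seqP[s ->]; have [UU _] := Unp.
elim: s => [|x s IHs].
  by rewrite set_nil; apply: filter_not_empty.
rewrite set_seq_cons => UxF; have [//|UnF] := in_ultra_setVsetC [set` s] UU.
apply: (nonprincipal_set1 (x := x) Unp).
by apply: filterS (filterI UxF UnF) => y [[]].
Qed.

Lemma nonprincipal_cofinite (T : choiceType) (U : set_system T) (F : set T) :
  nonprincipal_ultrafilter U -> finite_set (~` F) -> U F.
Proof.
move=> Unp finF; have [UU _] := Unp.
by have [//|/(nonprincipal_finite Unp)] := in_ultra_setVsetC F UU.
Qed.

(** * Idempotents and division in the adele ring *)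

Section Adele.
Variables (R : realType) (K : fieldExtType rat).
Implicit Types (v : place R K) (Y : set (place R K)) (a b c : adele R K).

Lemma adele_ext a b : (forall v, a v = b v) -> a = b.
Proof.
by move=> ab; apply: val_inj; exact: functional_extensionality_dep ab.
Qed.

Lemma adele1 v : (1 : adele R K) v = 1. Proof. by []. Qed.
Lemma adeleD a b v : (a + b) v = a v + b v. Proof. by []. Qed.
Lemma adeleM a b v : (a * b) v = a v * b v. Proof. by []. Qed.
Lemma adeleX a n v : (a ^+ n) v = a v ^+ n.
Proof. by elim: n => // n IHn; rewrite !exprS adeleM IHn. Qed.

Lemma local_int0 v : local_int (0 : Kv v).
Proof. by change (local_abs v 0 <= 1); rewrite absval0. Qed.

Lemma local_int1 v : local_int (1 : Kv v).
Proof. by change (local_abs v 1 <= 1); rewrite absval1. Qed.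

Definition adele_indic_fun Y : local_prod R K := fun v => if `[< Y v >] then 1 else 0.

Lemma adele_indic_almost_int Y : adele_indic_fun Y \in @almost_int R K.
Proof.
apply/asboolP; apply: sub_finite_set (finite_set0 _) => v [_]; apply.
rewrite /adele_indic_fun; case: asboolP => _; [exact: local_int1|exact: local_int0].
Qed.

Definition adele_indic Y : adele R K := Adele (adele_indic_almost_int Y).

Lemma adele_indicT Y v : Y v -> adele_indic Y v = 1.
Proof. by move=> Yv; rewrite /component /= /adele_indic_fun asboolT. Qed.

Lemma adele_indicF Y v : ~ Y v -> adele_indic Y v = 0.
Proof. by move=> Yv; rewrite /component /= /adele_indic_fun asboolF. Qed.

Lemma adele_indic_set0 : adele_indic set0 = 0.
Proof. by apply: adele_ext => v; rewrite adele_indicF. Qed.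

Lemma adele_indic_setT : adele_indic setT = 1.
Proof. by apply: adele_ext => v; rewrite adele_indicT. Qed.

Lemma adele_indicI Y Z : adele_indic (Y `&` Z) = adele_indic Y * adele_indic Z.
Proof.
apply: adele_ext => v; rewrite adeleM.
have [Yv|nYv] := pselect (Y v); last first.
  by rewrite (adele_indicF nYv) mul0r adele_indicF// => -[].
have [Zv|nZv] := pselect (Z v); last first.
  by rewrite (adele_indicF nZv) mulr0 adele_indicF// => -[].
by rewrite !adele_indicT// mulr1.
Qed.

Lemma adele_indicU Y Z : Y `&` Z = set0 ->
  adele_indic (Y `|` Z) = adele_indic Y + adele_indic Z.
Proof.
move=> YZ0; apply: adele_ext => v; rewrite adeleD.
have [Yv|nYv] := pselect (Y v).
  have nZv : ~ Z v by move=> Zv; have : (Y `&` Z) v by []; rewrite YZ0.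
  by rewrite (adele_indicT Yv) (adele_indicF nZv) addr0 adele_indicT//; left.
rewrite (adele_indicF nYv) add0r.
have [Zv|nZv] := pselect (Z v); first by rewrite !adele_indicT//; right.
by rewrite (adele_indicF nZv) adele_indicF// => -[].
Qed.

(** The quotient on [Y], extended by 0, is integral at all but finitely many places, hence an adele.
    At the zeros of [b] in [Y] the numerator vanishes too, so the convention for inverting 0 is
    harmless. *)
Lemma adele_div a b Y :
  (forall v, Y v -> b v = 0 -> a v = 0) ->
  finite_set [set v | Y v /\ ~ (local_abs v (a v) <= local_abs v (b v))] ->
  exists c, b * c = a * adele_indic Y.
Proof.
move=> b0 finY.
pose f : local_prod R K := fun v => if `[< Y v >] then a v / b v else 0.
have fP : f \in @almost_int R K.
  apply/asboolP; apply: sub_finite_set finY => v [_]; rewrite /f.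
  case: asboolP => Yv fv; last by exfalso; apply: fv; exact: local_int0.
  split=> // ab; apply: fv; change (local_abs v (a v / b v) <= 1).
  rewrite absvalM absvalV.
  have [bv0|bv0] := eqVneq (b v) 0; first by rewrite b0// absval0 mul0r.
  by rewrite ler_pdivrMr ?mul1r// absval_gt0.
exists (Adele fP); apply: adele_ext => v; rewrite !adeleM.
have -> : (Adele fP) v = f v by [].
rewrite /f; case: asboolP => Yv; last by rewrite (adele_indicF Yv) !mulr0.
rewrite (adele_indicT Yv) mulr1; have [bv0|bv0] := eqVneq (b v) 0.
  by rewrite bv0 mul0r b0.
by rewrite mulrC divfK.
Qed.

Lemma adele_div_le a b Y :
  (forall v, Y v -> local_abs v (a v) <= local_abs v (b v)) ->
  exists c, b * c = a * adele_indic Y.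
Proof.
move=> ab; apply: adele_div => [v Yv bv0|].
  apply/eqP; rewrite -(absval_eq0 (local_abs v)) eq_le absval_ge0 andbT.
  by rewrite (le_trans (ab v Yv))// bv0 absval0.
by apply: sub_finite_set (finite_set0 _) => v [/ab ?].
Qed.

(** * Idempotents in a prime ideal *)

Section PrimeIdeals.
Variable p : set (adele R K).
Hypothesis pP : prime_ideal p.

Lemma prime_indicU Y Z :
  p (adele_indic Y) -> p (adele_indic Z) -> p (adele_indic (Y `|` Z)).
Proof.
have [[[p0 pD pM] _] _] := pP => pY pZ.
have -> : Y `|` Z = Y `|` (~` Y `&` Z).
  apply/seteqP; split=> v; last by case=> [|[]]; [left|right].
  by case=> [|Zv]; [left|have [|] := pselect (Y v); [left|right]].
rewrite adele_indicU; last by rewrite setIA setICr set0I.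
by apply: pD => //; rewrite adele_indicI; exact: pM.
Qed.

Lemma prime_indic_finite Y :
  (forall v, p (adele_indic [set v])) -> finite_set Y -> p (adele_indic Y).
Proof.
move=> pv /finite_seqP[s ->]; elim: s => [|v s IHs].
  by rewrite set_nil adele_indic_set0; have [[[]]] := pP.
by rewrite set_seq_cons; exact: prime_indicU.
Qed.

Lemma prime_disjoint Y Z : Y `&` Z = set0 -> p (adele_indic Y) \/ p (adele_indic Z).
Proof.
have [[[p0 _ _] _] pp] := pP => YZ0.
by apply: pp; rewrite -adele_indicI YZ0 adele_indic_set0.
Qed.

(** An adele vanishing at [v] is killed by the idempotent at [v], which is outside [p]. *)
Lemma prime_sub v : ~ p (adele_indic [set v]) -> M_place v `<=` p.
Proof.
have [[[p0 _ _] _] pp] := pP => npv a av0.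
have /pp[//|//] : p (a * adele_indic [set v]).
suff -> : a * adele_indic [set v] = 0 by [].
apply: adele_ext => w; rewrite adeleM.
have [->|wv] := pselect (w = v); first by rewrite av0 mul0r.
by rewrite adele_indicF ?mulr0.
Qed.

End PrimeIdeals.

Lemma M_place_maximal v : maximal_ideal (@M_place R K v).
Proof.
split.
  split; last by change ((1 : Kv v) <> 0); apply/eqP; rewrite oner_eq0.
  split=> // [a b av0 bv0|a b bv0].
    by change (a v + b v = 0); rewrite av0 bv0 addr0.
  by change (a v * b v = 0); rewrite bv0 mulr0.
move=> J [[J0 JD JM] J1] vJ; apply/seteqP; split=> // a Ja.
apply: contrapT => av0; apply: J1.
(* Since [a v] is nonzero, the idempotent at [v] is a multiple of [a]; the complementary idempotent
   vanishes at [v]. Both lie in [J], and their sum is 1. *)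
have [c ac] : exists c, a * c = 1 * adele_indic [set v].
  apply: adele_div => [_ -> /av0//|].
  by apply: sub_finite_set (finite_set1 v) => w [].
rewrite -adele_indic_setT -(setUv [set v]) adele_indicU ?setICr//; apply: JD.
  by rewrite -[adele_indic _]mul1r -ac mulrC; exact: JM.
by apply: vJ; apply: adele_indicF; apply.
Qed.

Lemma M_place_minimal v : minimal_prime_ideal (@M_place R K v).
Proof.
split=> [|J JP Jv]; first exact/maximal_prime/M_place_maximal.
apply/seteqP; split=> //; apply: prime_sub => // /Jv.
change (adele_indic [set v] v <> 0); rewrite adele_indicT//.
by apply/eqP; rewrite oner_eq0.
Qed.

(** * The ultrafilter of a prime ideal *)

Section Ultra.
Variable S0 : set (place R K).
Hypothesis finS0 : finite_set S0.
Hypothesis archS0 : [set v : place R K | ~ nonarch v] `<=` S0.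
Implicit Types (U : set_system (Omega S0)) (Z : set (Omega S0)).

Local Notation omega_indic Z := (adele_indic (val @` Z)).

Lemma Omega_nonarch (v : Omega S0) : nonarch (val v).
Proof.
apply: contrapT => /archS0 S0v; have := valP v.
by rewrite inE; apply.
Qed.

Lemma val_imageP Z (v : Omega S0) : (val @` Z) (val v) <-> Z v.
Proof.
split=> [[w Zw /val_inj <-//]|Zv]; by exists v.
Qed.

Lemma val_imageI Z Z' : val @` (Z `&` Z') = (val @` Z) `&` (val @` Z').
Proof.
apply/seteqP; split=> v; first by move=> [w [Zw Zw'] <-]; split; exists w.
by move=> [[w Zw <-]] /val_imageP Z'w; exists w.
Qed.

Lemma val_imageT : val @` [set: Omega S0] = ~` S0.
Proof.
apply/seteqP; split=> v; first by move=> [w _ <-]; have := valP w; rewrite inE.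
move=> nS0v; have h : v \in ~` S0 by rewrite inE.
by exists (SigSub h).
Qed.

(** As [S0] is finite, its idempotent lies in [p]. The places are covered by [S0], [Z] and the
    complement of [Z] in [Omega S0], so otherwise 1 would lie in [p]. *)
Lemma omega_indic_setC (p : set (adele R K)) Z : prime_ideal p ->
  (forall v, p (adele_indic [set v])) -> p (omega_indic Z) ->
  p (omega_indic (~` Z)) -> False.
Proof.
move=> pP pv pZ pnZ; have [[_ p1] _] := pP; apply: p1.
rewrite -adele_indic_setT -(setUv S0); apply: prime_indicU => //.
  exact: prime_indic_finite.
by rewrite -val_imageT -(setUv Z) image_setU; exact: prime_indicU.
Qed.

Lemma omega_indic_setCW (p : set (adele R K)) Z : prime_ideal p ->
  p (omega_indic Z) \/ p (omega_indic (~` Z)).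
Proof.
by move=> pP; apply: prime_disjoint => //; rewrite -val_imageI setICr image_set0.
Qed.

Lemma prime_between (p : set (adele R K)) : prime_ideal p ->
  (forall v, p (adele_indic [set v])) ->
  exists2 U : set_system (Omega S0), nonprincipal_ultrafilter U &
    m_ultra U `<=` p /\ p `<=` M_ultra U.
Proof.
move=> pP pv; have [[[p0 pD pM] p1] pp] := pP.
(* Modulo [p] every idempotent is 0 or 1; [U] collects the sets whose idempotent becomes 1. *)
pose U : set_system (Omega S0) := [set Z | ~ p (omega_indic Z)].
have UU : UltraFilter U.
  apply/ultrafilterP; split.
  - exists setT => pT; apply: (omega_indic_setC (Z := setT) pP pv pT).
    by rewrite setCT image_set0 adele_indic_set0.
  - by apply; rewrite image_set0 adele_indic_set0.
  - by move=> A B UA UB; rewrite /U /= val_imageI adele_indicI => /pp[].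
  - move=> A B AB UA pB; apply: UA; have -> : A = A `&` B by apply/esym/setIidPl.
    by rewrite val_imageI adele_indicI; exact: pM.
  - move=> A; have [UA|pA] := pselect (U A).
      left; split=> //; apply.
      by have [/UA|] := omega_indic_setCW A pP.
    right; split=> // pnA; apply: (omega_indic_setC pP pv _ pnA).
    exact: contrapT.
have Unp : nonprincipal_ultrafilter U.
  split=> // -[x Ux]; have : U [set x] by rewrite Ux; exact/principal_filterP.
  by apply; rewrite image_set1.
exists U => //; split=> a.
  move=> aZ; have /pp[|//] : p (a * omega_indic [set v : Omega S0 | a (val v) = 0]);
    last by move: aZ.
  suff -> : a * omega_indic [set v : Omega S0 | a (val v) = 0] = 0 by [].
  apply: adele_ext => v; rewrite adeleM.
  set Z := [set _ | _]; have [[w Zw <-]|nv] := pselect ((val @` Z) v).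
    by rewrite Zw mul0r.
  by rewrite (adele_indicF nv) mulr0.
move=> pa; apply: contrapT => nU.
have [//|UZ] := in_ultra_setVsetC [set v : Omega S0 | local_max (a (val v))] UU.
(* Where [a] is outside the maximal ideal its absolute value is at least 1, so [a] divides the
   idempotent of that set. *)
apply: UZ; have [c ac] : exists c, a * c =
    1 * omega_indic (~` [set v : Omega S0 | local_max (a (val v))]).
  apply: adele_div_le => _ [v /negP nv <-]; rewrite adele1 absval1.
  by rewrite leNgt.
by rewrite -[adele_indic _]mul1r -ac mulrC; exact: pM.
Qed.

(** * The two ideals of a non-principal ultrafilter *)

Section NonPrincipal.
Variable U : set_system (Omega S0).
Hypothesis Unp : nonprincipal_ultrafilter U.

Let UU : UltraFilter U. Proof. by case: Unp. Qed.
Local Existing Instance UU.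

Let ultra0 : ~ U set0. Proof. exact: (@filter_not_empty _ U _). Qed.

Let ultraS A B : U A -> A `<=` B -> U B.
Proof. by move=> UA AB; exact: filterS UA. Qed.

Let ultraSI A B C : U A -> U B -> A `&` B `<=` C -> U C.
Proof. by move=> UA UB; apply: ultraS; exact: filterI. Qed.

(** An adele is integral at almost all places and [U] contains all cofinite sets. This makes
    [M_ultra U] stable under multiplication by arbitrary adeles. *)
Lemma ultra_local_int a : U [set v : Omega S0 | local_int (a (val v))].
Proof.
apply: nonprincipal_cofinite Unp _.
have /asboolP fin := adele_valP a.
apply: sub_finite_set (finite_preimage (f := val) _ fin).
  by move=> v /= nv; split=> //; exact: (Omega_nonarch v).
by move=> v w _ _; exact: val_inj.
Qed.

Lemma M_ultra_ideal : is_proper_ideal (M_ultra U).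
Proof.
split; last first.
  move=> U1; apply: ultra0; apply: (ultraS U1) => v.
  change (local_abs (val v) 1 < 1 -> False).
  by rewrite absval1 ltxx.
split=> [|a b Ua Ub|a b Ub].
- apply: filterE => v.
  by change (local_abs (val v) 0 < 1); rewrite absval0 ltr01.
- apply: (ultraSI Ua Ub) => v [av bv].
  change (local_abs (val v) (a (val v) + b (val v)) < 1).
  apply: le_lt_trans (completion_abs_max (Omega_nonarch v) _ _) _.
  by rewrite gt_max; apply/andP.
- apply: (ultraSI (ultra_local_int a) Ub) => v [av bv].
  change (local_abs (val v) (a (val v) * b (val v)) < 1).
  rewrite absvalM; apply: le_lt_trans bv.
  by rewrite ler_piMl ?absval_ge0.
Qed.

Lemma M_ultra_maximal : maximal_ideal (M_ultra U).
Proof.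
split=> [|J [[J0 JD JM] J1] UJ]; first exact: M_ultra_ideal.
apply/seteqP; split=> // a Ja; apply: contrapT => nUa; apply: J1.
pose Z : set (Omega S0) := [set v | local_max (a (val v))].
have [//|UZ] := in_ultra_setVsetC Z UU.
(* The idempotent of the complement of [Z] is a multiple of [a], hence in [J]; one minus it vanishes
   on a member of [U], hence lies in [M_ultra U]. So [J] contains 1. *)
have [c ac] : exists c, a * c = 1 * omega_indic (~` Z).
  apply: adele_div_le => _ [v /negP nv <-]; rewrite adele1 absval1.
  by rewrite leNgt.
rewrite -adele_indic_setT -(setUv (val @` (~` Z))) adele_indicU ?setICr//; apply: JD.
  by rewrite -[adele_indic _]mul1r -ac mulrC; exact: JM.
apply: UJ; apply: (ultraS UZ) => v nZv.
change (local_abs (val v) (adele_indic (~` (val @` (~` Z))) (val v)) < 1).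
by rewrite adele_indicF ?absval0 ?ltr01//; apply; exists v.
Qed.

Lemma m_ultra_prime : prime_ideal (m_ultra U).
Proof.
split; [split|].
- split=> [|a b Ua Ub|a b Ub].
  + by apply: filterE.
  + apply: (ultraSI Ua Ub) => v [av bv].
    by change (a (val v) + b (val v) = 0); rewrite av bv addr0.
  + apply: (ultraS Ub) => v bv.
    by change (a (val v) * b (val v) = 0); rewrite bv mulr0.
- move=> U1; apply: (@filter_not_empty _ U _); apply: (ultraS U1) => v.
  by move/eqP; rewrite [_ == _](oner_eq0 (Kv (val v))).
- move=> a b Uab.
  have [|UZ] := in_ultra_setVsetC [set v : Omega S0 | a (val v) = 0] UU.
    by left.
  right; apply: (ultraSI Uab UZ) => v [abv /eqP av]; apply/eqP.
  by move/eqP: abv; rewrite adeleM mulf_eq0 (negbTE av).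
Qed.

Lemma m_ultra_sub_M_ultra : m_ultra U `<=` M_ultra U.
Proof.
move=> a Ua; apply: (ultraS Ua) => v av.
by change (local_abs (val v) (a (val v)) < 1); rewrite av absval0 ltr01.
Qed.

Lemma adele_indic_set1_m_ultra v : m_ultra U (adele_indic [set v]).
Proof.
apply: nonprincipal_cofinite Unp _.
apply: sub_finite_set (finite_preimage (f := val) _ (finite_set1 v)).
  by move=> w nw; apply: contrapT => nv; apply: nw; exact: adele_indicF.
by move=> w w' _ _; exact: val_inj.
Qed.

Lemma m_ultra_not_sub_M_place v : ~ m_ultra U `<=` M_place v.
Proof.
move=> /(_ _ (adele_indic_set1_m_ultra v)).
change (adele_indic [set v] v <> 0); rewrite adele_indicT//.
by apply/eqP; rewrite oner_eq0.
Qed.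

(** For [Z] in [U'], the idempotent of the complement of [Z] lies in [m_ultra U'], hence in
    [M_ultra U]. Its components are 0 or 1, so [Z] is in [U]; maximality of [U'] gives equality. *)
Lemma m_ultra_sub_inj (U' : set_system (Omega S0)) :
  UltraFilter U' -> m_ultra U' `<=` M_ultra U -> U' = U.
Proof.
move=> UU' U'U; symmetry; apply: max_filter => Z U'Z.
have : M_ultra U (omega_indic (~` Z)).
  apply: U'U; apply: filterS U'Z => v Zv.
  by apply: adele_indicF => /val_imageP; apply.
apply: filterS => v; apply: contraPP => nZv.
change (~ (local_abs (val v) (adele_indic (val @` (~` Z)) (val v)) < 1)).
by rewrite adele_indicT ?absval1 ?ltxx//; apply/val_imageP.
Qed.

End NonPrincipal.

(** * Classification of the prime ideals *)

Lemma prime_ideal_cases (p : set (adele R K)) : prime_ideal p ->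
  (exists v, p = M_place v) \/
  exists2 U : set_system (Omega S0), nonprincipal_ultrafilter U &
    m_ultra U `<=` p /\ p `<=` M_ultra U.
Proof.
move=> pP; have [pv|] := pselect (forall v, p (adele_indic [set v])).
  by right; exact: prime_between.
move=> /existsNP[v npv]; left; exists v.
apply: (M_place_maximal v).2; last exact: prime_sub.
by case: pP.
Qed.

(** A smaller prime [J] equal to some [M_place v] would, by maximality, make [M_ultra U] equal to
    [M_place v], which does not contain [m_ultra U]. Otherwise [J] contains some [m_ultra U'], and
    [m_ultra_sub_inj] gives [U' = U]. *)
Lemma m_ultra_minimal U : nonprincipal_ultrafilter U ->
  minimal_prime_ideal (m_ultra U).
Proof.
move=> Unp; split=> [|J JP JU]; first exact: m_ultra_prime.
have UM := m_ultra_sub_M_ultra Unp.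
have [[v Jv]|[U' U'np [U'J _]]] := prime_ideal_cases JP.
  exfalso; apply: (m_ultra_not_sub_M_place Unp (v := v)).
  rewrite -((M_place_maximal v).2 (M_ultra U)) ?Jv//.
    exact: M_ultra_ideal.
  by rewrite -Jv; exact: subset_trans UM.
have UE : U' = U.
  apply: m_ultra_sub_inj => //; first by case: U'np.
  exact/(subset_trans U'J)/(subset_trans JU).
by apply/seteqP; split=> //; rewrite -UE.
Qed.

Lemma maximal_idealP (M : set (adele R K)) : maximal_ideal M <->
  (exists v, M = M_place v) \/
  (exists2 U : set_system (Omega S0), nonprincipal_ultrafilter U & M = M_ultra U).
Proof.
split=> [Mmax|[[v ->]|[U Unp ->]]]; last 2 first.
- exact: M_place_maximal.
- exact: M_ultra_maximal.
have [|[U Unp [_ MU]]] := prime_ideal_cases (maximal_prime Mmax); first by left.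
by right; exists U => //; rewrite (Mmax.2 (M_ultra U))//; exact: M_ultra_ideal.
Qed.

Lemma minimal_prime_idealP (m : set (adele R K)) : minimal_prime_ideal m <->
  (exists v, m = M_place v) \/
  (exists2 U : set_system (Omega S0), nonprincipal_ultrafilter U & m = m_ultra U).
Proof.
split=> [mmin|[[v ->]|[U Unp ->]]]; last 2 first.
- exact: M_place_minimal.
- exact: m_ultra_minimal.
have [|[U Unp [Um _]]] := prime_ideal_cases mmin.1; first by left.
by right; exists U => //; rewrite (mmin.2 (m_ultra U))//; exact: m_ultra_prime.
Qed.

Lemma prime_p_ultra (p : set (adele R K)) U : prime_ideal p ->
  nonprincipal_ultrafilter U -> m_ultra U `<=` p -> p `<=` M_ultra U ->
  p = \bigcup_(beta in p `&` int_adele S0) p_ultra U beta.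
Proof.
move=> pP Unp Up pU; have [UU _] := Unp; have [[[p0 pD pM] _] pp] := pP.
apply/seteqP; split=> [a pa|a [b [pb _] [Y UY [n n1 ab]]]].
  pose Z : set (Omega S0) := [set v | local_max (a (val v))].
  (* Cutting [a] down to [Z] keeps it in [p] and makes it integral outside [S0]. It agrees with [a]
     on [Z], a member of [U] because [p] lies in [M_ultra U], so the exponent 1 works. *)
  exists (a * omega_indic Z).
    split; first by rewrite mulrC; exact: pM.
    move=> v nS0v; change (local_abs v (a v * omega_indic Z v) <= 1).
    have [[w Zw <-]|nZv] := pselect ((val @` Z) v).
      by rewrite adele_indicT ?mulr1; [exact: ltW|exists w].
    by rewrite (adele_indicF nZv) mulr0 absval0 ler01.
  exists Z; first exact: pU.
  exists 1%N => // v Zv; rewrite adeleM adele_indicT ?mulr1//.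
(* Conversely, [b] divides [a ^+ n] on [Y], and the idempotent of [Y] is outside [M_ultra U], hence
   outside [p]; primality then gives [a] in [p]. *)
have [c bc] : exists c, b * c = a ^+ n * omega_indic Y.
  apply: adele_div_le => _ [v Yv <-]; rewrite adeleX.
  by apply: ord_at_le (ab v Yv); exact: (Omega_nonarch v).
apply: (prime_idealX (n := n) pP).
have : p (a ^+ n * omega_indic Y) by rewrite -bc mulrC; exact: pM.
move=> /pp[//|/pU pY]; exfalso.
apply: (ultrafilter_disjoint UU UY pY).
apply/seteqP; split=> // v [Yv].
change (local_abs (val v) (omega_indic Y (val v)) < 1 -> False).
by rewrite adele_indicT ?absval1 ?ltxx//; exists v.
Qed.

End Ultra.
End Adele.
End PrimesOfAdeleRing.

Theorem theorem4p3 (R : realType) (K : fieldExtType rat)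
    (S0 : set (place R K)) (finS0 : finite_set S0)
    (archS0 : [set v : place R K | ~ nonarch v] `<=` S0) :
  [/\ (forall M : set (adele R K),
         maximal_ideal M <->
           (exists v0 : place R K, M = M_place v0) \/
           (exists2 U : set_system (Omega S0),
              nonprincipal_ultrafilter U & M = M_ultra U)) /\
      (forall v0 : place R K, minimal_prime_ideal (M_place v0)),
      [/\ forall m : set (adele R K),
            minimal_prime_ideal m <->
              (exists v0 : place R K, m = M_place v0) \/
              (exists2 U : set_system (Omega S0),
                 nonprincipal_ultrafilter U & m = m_ultra U),
          forall v0 : place R K, maximal_ideal (M_place v0) &
          forall U : set_system (Omega S0), nonprincipal_ultrafilter U ->
            (forall m : set (adele R K),
               minimal_prime_ideal m /\ m `<=` M_ultra U <-> m = m_ultra U) /\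
            (forall M : set (adele R K),
               maximal_ideal M /\ m_ultra U `<=` M <-> M = M_ultra U)] &
      forall p : set (adele R K), prime_ideal p ->
        ~ maximal_ideal p -> ~ minimal_prime_ideal p ->
        exists U : set_system (Omega S0),
          [/\ nonprincipal_ultrafilter U,
              m_ultra U `<` p /\ p `<` M_ultra U,
              forall U' : set_system (Omega S0), nonprincipal_ultrafilter U' ->
                m_ultra U' `<` p -> p `<` M_ultra U' -> U' = U &
              p = \bigcup_(beta in p `&` int_adele S0) p_ultra U beta]].
Proof.
split; [split| split |].
- by move=> M; exact: maximal_idealP.
- exact: M_place_minimal.
- by move=> m; exact: minimal_prime_idealP.
- exact: M_place_maximal.
- move=> U Unp; have UM := m_ultra_sub_M_ultra Unp; split.
    move=> m; split=> [[mmin mU]|->]; last by split=> //; exact: m_ultra_minimal.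
    have [[v mv]|[U' U'np mU']] := (minimal_prime_idealP finS0 archS0 m).1 mmin.
      (* A maximal [M_place v] inside [M_ultra U] would equal it, and so contain [m_ultra U]. *)
      exfalso; apply: (m_ultra_not_sub_M_place Unp (v := v)).
      rewrite -((M_place_maximal v).2 (M_ultra U)) -?mv//.
      exact: M_ultra_ideal.
    have [UU' _] := U'np.
    by rewrite mU' (m_ultra_sub_inj Unp UU')// -mU'.
  move=> M; split=> [[Mmax UM']|->]; last by split=> //; exact: M_ultra_maximal.
  have [[v Mv]|[U' U'np MU']] := (maximal_idealP finS0 archS0 M).1 Mmax.
    by exfalso; apply: (m_ultra_not_sub_M_place Unp (v := v)); rewrite -Mv.
  have [UU _] := Unp.
  by rewrite MU' (m_ultra_sub_inj U'np UU)// -MU'.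
- move=> p pP pnmax pnmin.
  have [[v pv]|[U Unp [Up pU]]] := prime_ideal_cases finS0 pP.
    by exfalso; apply: pnmax; rewrite pv; exact: M_place_maximal.
  exists U; split=> //.
  + split; split=> // pE.
      apply: pnmin; rewrite (_ : p = m_ultra U); first exact: m_ultra_minimal.
      exact/seteqP.
    apply: pnmax; rewrite (_ : p = M_ultra U); first exact: M_ultra_maximal.
    exact/seteqP.
  (* Uniqueness follows from the chain of inclusions of [m_ultra U'] in [p] and of [p] in
     [M_ultra U]. *)
  + move=> U' [UU' _] [U'p _] _; apply: (m_ultra_sub_inj Unp UU').
    exact: subset_trans pU.
  + exact: prime_p_ultra.
Qed.
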